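(* Every Shidoku board is represented by one of the six boards $a$–$f$ listed in the context; that is, every Shidoku board lies in the $H_4$-orbit of one of $a,\dots,f$. The action of $S_4=\langle (12),(23),(34),(14)\rangle$ on this set of representatives (equivalently, on the set of $H_4$-orbits) is given by: - $(12)$ and $(34)$ each act by $a\leftrightarrow c$, $f\mapsto f$, $b\leftrightarrow d$, $e\mapsto e$; - $(23)$ and $(14)$ each act by $c\leftrightarrow f$, $a\mapsto a$, $d\leftrightarrow e$, $b\mapsto b$. Moreover, let $S'$ be a subgroup of $S_4$ and let $X$ be a set of generators of $S'$. Then $H_4\times S'$ is a complete Shidoku symmetry group if and only if the graph with vertex set $\{a,\dots,f\}$ and with an edge joining $p$ and $\sigma\cdot p$ for every $p\in\{a,\dots,f\}$ and $\sigma\in X$ has exactly two connected components.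
   Context: A Shidoku board is a $4\times 4$ array with entries in $\{1,2,3,4\}$ such that each row, each column, and each of the four $2\times 2$ corner blocks (rows $\{1,2\}$ or $\{3,4\}$, columns $\{1,2\}$ or $\{3,4\}$) contains each of $1,2,3,4$ exactly once. Let $\mathcal{S}$ be the set of Shidoku boards; $|\mathcal{S}| = 288$. Number the cells $1,\dots,16$ from left to right and then top to bottom and write a board as $B=(b_1,\dots,b_{16})$. A permutation $x\in S_{16}$ acts on boards by moving the value $b_i$ in cell $i$ to cell $x(i)$. The position symmetry group $H_4\le S_{16}$ is the group of all cell permutations that send every Shidoku board to a Shidoku board. It has order $128$ and is generated by $r$ (rotation of the board by a quarter turn clockwise), $s$ (swap of the third and fourth rows), and $t$ (transpose of the board). The group $S_4$ acts on $\mathcal{S}$ by relabeling: $\sigma\in S_4$ replaces each entry $b_i$ by $\sigma(b_i)$. The two actions commute, and the full Shidoku symmetry group is $G_4=H_4\times S_4$. It has exactly two orbits on $\mathcal{S}$, of sizes $96$ and $192$. A group of Shidoku symmetries (here, a subgroup of $G_4$) is called a complete Shidoku symmetry group if its orbits on $\mathcal{S}$ are exactly the two orbits of $G_4$. The orbits of $H_4$ on $\mathcal{S}$ are called $H_4$-nests. Since the actions commute, $S_4$ acts on the set of $H_4$-nests. There are exactly six $H_4$-nests, with one representative in each given by the boards (rows listed from top to bottom, separated by slashes): $a=1234/3412/2143/4321$, $b=1234/4312/2143/3421$, $c=1243/4312/2134/3421$, $d=1324/4213/3142/2431$, $e=1342/4213/2134/3421$, $f=1342/4213/3124/2431$. The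 nest containing each of these boards is denoted by the same letter. For $\sigma\in S_4$ and representatives $p,q$, the statement $\sigma\cdot p=q$ (written $p\mapsto q$) means that $\sigma(p)$ lies in the $H_4$-nest of $q$; $p\leftrightarrow q$ means $p\mapsto q$ and $q\mapsto p$.
   Formalization: The printed action on b, d, e is false for the listed boards: (12) does not send b to the nest of d. It is corrected so that (12) and (34) act by d↔e, b↦b, and (23) and (14) act by b↔d, e↦e; the rest is as stated. *)

(* Defs.v *)
From mathcomp Require Import all_boot all_fingroup.

Set Implicit Arguments.
Unset Strict Implicit.
Unset Printing Implicit Defensive.

(* Cells 1..16 (left to right, then top to bottom) are the ordinals 0..15 and
   entries 1..4 are the ordinals 0..3; [entry k] is the entry written k. *)
Notation cell := 'I_16.
Notation board := {ffun 'I_16 -> 'I_4}.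

Definition entry (k : nat) : 'I_4 := inord k.-1.

Definition board_of (s : seq nat) : board := [ffun i : cell => entry (nth 1 s i)].

Definition in_row (k : 'I_4) : {set cell} := [set i : cell | i %/ 4 == k].
Definition in_col (k : 'I_4) : {set cell} := [set i : cell | i %% 4 == k].
Definition in_block (k : 'I_4) : {set cell} :=
  [set i : cell | 2 * (i %/ 4 %/ 2) + (i %% 4 %/ 2) == k].

Definition each_once (A : {set cell}) (B : board) : bool :=
  [forall v : 'I_4, #|[set i in A | B i == v]| == 1].

Definition shidoku : {set board} :=
  [set B : board | [forall k : 'I_4,
     [&& each_once (in_row k) B, each_once (in_col k) B
       & each_once (in_block k) B]]].

Definition board_a := board_of [:: 1; 2; 3; 4;  3; 4; 1; 2;  2; 1; 4; 3;  4; 3; 2; 1].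
Definition board_b := board_of [:: 1; 2; 3; 4;  4; 3; 1; 2;  2; 1; 4; 3;  3; 4; 2; 1].
Definition board_c := board_of [:: 1; 2; 4; 3;  4; 3; 1; 2;  2; 1; 3; 4;  3; 4; 2; 1].
Definition board_d := board_of [:: 1; 3; 2; 4;  4; 2; 1; 3;  3; 1; 4; 2;  2; 4; 3; 1].
Definition board_e := board_of [:: 1; 3; 4; 2;  4; 2; 1; 3;  2; 1; 3; 4;  3; 4; 2; 1].
Definition board_f := board_of [:: 1; 3; 4; 2;  4; 2; 1; 3;  3; 1; 2; 4;  2; 4; 3; 1].

Definition representatives : {set board} :=
  [set board_a; board_b; board_c; board_d; board_e; board_f].

Import GroupScope.

(* Permutations compose from left to right ((x * y) i = y (x i)), so moving
   the value in cell i to cell x i is a right action. *)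
Definition move (B : board) (x : {perm cell}) : board :=
  [ffun j => B (x^-1 j)].

Lemma move1 : move^~ 1 =1 id.
Proof. by move=> B; apply/ffunP=> j; rewrite ffunE invg1 perm1. Qed.

Lemma moveM B : act_morph move B.
Proof.
by move=> x y; apply/ffunP=> j; rewrite !ffunE invMg permM.
Qed.

Canonical move_action := TotalAction move1 moveM.

Definition relabel (B : board) (u : 'S_4) : board := [ffun i => u (B i)].

Lemma relabel1 : relabel^~ 1 =1 id.
Proof. by move=> B; apply/ffunP=> i; rewrite ffunE perm1. Qed.

Lemma relabelM B : act_morph relabel B.
Proof. by move=> u v; apply/ffunP=> i; rewrite !ffunE permM. Qed.

Canonical relabel_action := TotalAction relabel1 relabelM.

Definition symm (B : board) (g : {perm cell} * 'S_4) : board :=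
  relabel (move B g.1) g.2.

Lemma symm1 : symm^~ 1 =1 id.
Proof. by move=> B; rewrite /symm move1 relabel1. Qed.

Lemma symmM B : act_morph symm B.
Proof.
by move=> g h; apply/ffunP=> i; rewrite !ffunE /= invMg !permM.
Qed.

Canonical symm_action := TotalAction symm1 symmM.

(* The cell permutations mapping the set of Shidoku boards into itself. *)
Definition H4 : {group {perm cell}} := 'N(shidoku | move_action)%G.

Definition G4 : {group {perm cell} * 'S_4} := setX_group H4 [group of [set: 'S_4]].

Definition orbits_on_shidoku (G : {set {perm cell} * 'S_4}) : {set {set board}} :=
  [set orbit symm_action G B | B in shidoku].

Definition complete_symmetry_group (G : {group {perm cell} * 'S_4}) : Prop :=
  G \subset G4 /\ orbits_on_shidoku G = orbits_on_shidoku G4.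

Definition nest (B : board) : {set board} := orbit move_action H4 B.

(* u . p = q.  In a board, the two rows of a band (the two columns of a stack)
   split {1,2,3,4} into the same two pairs.  Exactly one of the three splittings
   occurs twice in parallel directions for b, d and e: 12|34 for the bands of b,
   13|24 for the bands of d, 14|23 for the stacks of e.  Hence (12) and (34)
   fix the nest of b and exchange those of d and e, while (23) and (14) fix the
   nest of e and exchange those of b and d; a table giving the action with
   these two interchanged is inconsistent with the boards above. *)
Definition sends (u : 'S_4) (p q : board) : bool := relabel p u \in nest q.

Definition swaps (u : 'S_4) (p q : board) : Prop := sends u p q /\ sends u q p.

Definition transp (i j : nat) : 'S_4 := tperm (entry i) (entry j).

Definition rep_graph (X : {set 'S_4}) : rel board :=
  fun p q => [&& p \in representatives, q \in representatives
    & [exists u in X, sends u p q || sends u q p]].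

Definition components (X : {set 'S_4}) : nat :=
  n_comp (rep_graph X) representatives.

(* Main.v *)
Require Import Defs.
From mathcomp Require Import all_boot all_fingroup.

Set Implicit Arguments.
Unset Strict Implicit.
Unset Printing Implicit Defensive.

(* A cell permutation preserving the relation "in a common row, column or block"
   lies in H4, which yields explicit elements of H4: transposition, swaps of two
   parallel rows or columns of a band or stack, and swaps of the two bands or
   stacks.  Their products carry the six representatives to all 288 boards,
   which are enumerated by backtracking, and give the table of the action.

   H4 itself is only known as a stabiliser, so nests are separated by invariants:
   for each value, count the cells where B has this value and agrees with another
   board C.  The set of count vectors obtained as C runs over all boards depends
   only on the nest of B, and separates the six nests.  The total count 1 occurs
   for b but not for a, and the total is also invariant under relabeling, so G4
   has at least two orbits on boards; the table of the action gives at most two.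

   Hence two representatives are connected in the graph of X exactly when they
   lie in one orbit of H4 x <X>, and the number of components is the number of
   such orbits.  Each orbit of G4 is a union of orbits of H4 x <X>, so the two
   orbit partitions agree as soon as they have the same number of parts. *)

(** * Boards as proper colourings of the peer relation on cells *)

Definition row (i : nat) := i %/ 4.
Definition col (i : nat) := i %% 4.
Definition block (i : nat) := 2 * (i %/ 4 %/ 2) + (i %% 4 %/ 2).

Definition peer (i j : nat) :=
  [|| row i == row j, col i == col j | block i == block j].

Lemma peer_sym i j : peer i j = peer j i.
Proof.
by rewrite /peer (eq_sym (row i)) (eq_sym (col i)) (eq_sym (block i)).
Qed.

Lemma line_bound (i : cell) : [&& row i < 4, col i < 4 & block i < 4].
Proof.
have /allP/(_ i) : all (fun i => [&& row i < 4, col i < 4 & block i < 4]) (iota 0 16).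
  by vm_compute.
by apply; rewrite mem_iota add0n ltn_ord.
Qed.

Lemma card_cell (P : pred nat) : #|[set i : cell | P i]| = count P (iota 0 16).
Proof.
rewrite cardsE cardE /enum_mem size_filter -enumT -val_enum_ord count_map.
exact: eq_count.
Qed.

(** Four cells face four values, so injectivity on the line forces surjectivity. The index function
    [l] stands for [row], [col] or [block]. *)
Lemma each_onceP (l : nat -> nat) (k : 'I_4) (B : board) :
    count (fun i => l i == k) (iota 0 16) = 4 ->
  reflect {in [set i : cell | l i == k] &, injective B}
          (each_once [set i : cell | l i == k] B).
Proof.
move=> card4; set A := [set i : cell | l i == k].
have cardA : #|A| = 4 by rewrite (card_cell (fun i => l i == k)).
apply: (iffP forallP) => [once i j Ai Aj eqB | injB v].
  have /cards1P[x defx] := once (B i).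
  have: i \in [set i' in A | B i' == B i] by rewrite inE Ai eqxx.
  have: j \in [set i' in A | B i' == B i] by rewrite inE Aj eqB eqxx.
  by rewrite defx !inE => /eqP-> /eqP->.
have surjB : B @: A = [set: 'I_4].
  by apply/eqP; rewrite eqEcard subsetT cardsT card_ord card_in_imset // cardA.
have /imsetP[i Ai ->] : v \in B @: A by rewrite surjB inE.
apply/cards1P; exists i; apply/setP=> j; rewrite !inE.
apply/andP/eqP=> [[lj /eqP eqB] | ->]; first by apply: injB; rewrite // inE.
by split=> //; rewrite inE in Ai.
Qed.

Lemma card_lines (k : 'I_4) :
  [/\ count (fun i => row i == k) (iota 0 16) = 4,
      count (fun i => col i == k) (iota 0 16) = 4
    & count (fun i => block i == k) (iota 0 16) = 4].
Proof. by case: k => [[|[|[|[|]]]]]. Qed.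

(** In this form a board visibly stays a board under any relabeling and any cell permutation that
    preserves peers. *)
Lemma shidokuP (B : board) :
  reflect (forall i j : cell, i != j -> peer i j -> B i != B j) (B \in shidoku).
Proof.
have line_neq (l : nat -> nat) (i j : cell) :
    (forall k : 'I_4, count (fun i => l i == k) (iota 0 16) = 4) ->
    (forall k : 'I_4, each_once [set i : cell | l i == k] B) -> l i < 4 ->
    i != j -> l i == l j -> B i != B j.
  move=> card4 once lt4 neq_ij eq_l.
  have /each_onceP-/(_ (card4 _)) injB := once (Ordinal lt4).
  by apply: contraNneq neq_ij => eqB; apply/eqP/injB; rewrite ?inE //= eq_sym.
rewrite inE; apply: (iffP forallP) => [once i j neq_ij | properB k].
  have /and3P[lt_row lt_col lt_block] := line_bound i.
  case/or3P; apply: line_neq => // k; try by case: (card_lines k).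
  - by case/and3P: (once k).
  - by case/and3P: (once k).
  - by case/and3P: (once k).
have [row4 col4 block4] := card_lines k.
have inj_line (l : nat -> nat) : (forall i j, l i == l j -> peer i j) ->
    {in [set i : cell | l i == k] &, injective B}.
  move=> l_peer i j; rewrite !inE => /eqP li /eqP lj eqB; apply/eqP.
  apply: contraT => neq_ij; have := properB i j neq_ij.
  by rewrite eqB eqxx; apply; apply: l_peer; rewrite li lj.
apply/and3P; split.
- apply/(each_onceP (l := row)) => //; apply: inj_line => i j eq_ij.
  by rewrite /peer eq_ij.
- apply/(each_onceP (l := col)) => //; apply: inj_line => i j eq_ij.
  by rewrite /peer eq_ij orbT.
- apply/(each_onceP (l := block)) => //; apply: inj_line => i j eq_ij.
  by rewrite /peer eq_ij !orbT.
Qed.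

(** * Boards as lists of numbers, and their enumeration *)

Definition valid (s : seq nat) : bool :=
  [&& size s == 16, all (fun v => 0 < v <= 4) s
    & all (fun i => all (fun j => peer i j ==> (nth 1 s i != nth 1 s j)) (iota 0 i))
          (iota 0 16)].

Lemma valid_entry s i : valid s -> 0 < nth 1 s i <= 4.
Proof.
case/and3P=> _ range_s _; have [lt_i | ge_i] := ltnP i (size s).
  exact: (all_nthP 1 range_s).
(* Beyond the end of the list, the default 1 is itself in range. *)
by rewrite nth_default.
Qed.

Lemma entryK m : 0 < m <= 4 -> (entry m).+1 = m.
Proof. by case: m => // m lt_m; rewrite /entry inordK. Qed.

Lemma entry_inj : {in [pred m | 0 < m <= 4] &, injective entry}.
Proof. by move=> m n m4 n4 eq_mn; rewrite -(entryK m4) eq_mn entryK. Qed.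

Lemma board_ofE s i : valid s -> (board_of s i).+1 = nth 1 s i :> nat.
Proof. by move=> s_ok; rewrite ffunE entryK ?valid_entry. Qed.

Lemma board_of_eq s t i j : valid s -> valid t ->
  (board_of s i == board_of t j) = (nth 1 s i == nth 1 t j).
Proof. by move=> s_ok t_ok; rewrite -!board_ofE. Qed.

Lemma valid_shidoku s : valid s -> board_of s \in shidoku.
Proof.
move=> s_ok; case/and3P: (s_ok) => _ _ /allP proper_s.
have lt_neq (i j : cell) : j < i -> peer i j -> board_of s i != board_of s j.
  move=> lt_ji peer_ij; rewrite board_of_eq //.
  have /proper_s/allP/(_ j) : val i \in iota 0 16 by rewrite mem_iota add0n ltn_ord.
  by rewrite mem_iota add0n lt_ji peer_ij /=; apply.
apply/shidokuP=> i j; rewrite neq_ltn => /orP[lt_ij | lt_ji]; last exact: lt_neq.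
by rewrite peer_sym eq_sym; apply: lt_neq.
Qed.

Definition fits (s : seq nat) (v : nat) :=
  all (fun j => peer (size s) j ==> (v != nth 1 s j)) (iota 0 (size s)).

Definition extensions (L : seq (seq nat)) : seq (seq nat) :=
  [seq rcons s v | s <- L, v <- [seq v <- iota 1 4 | fits s v]].

Definition boards : seq (seq nat) := iter 16 extensions [:: [::]].

Definition code (B : board) : seq nat := mkseq (fun i => (B (inord i)).+1) 16.

Lemma codeK : cancel code board_of.
Proof.
move=> B; apply/ffunP=> i; rewrite ffunE nth_mkseq // inord_val.
exact: inord_val.
Qed.

(** Each prefix of the code survives its round of backtracking, because a new entry has to differ
    only from those of earlier peers. *)
Lemma code_boards B : B \in shidoku -> code B \in boards.
Proof.
move/shidokuP=> properB; pose b i := (B (inord i)).+1.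
suffices prefix n : n <= 16 -> mkseq b n \in iter n extensions [:: [::]].
  exact: prefix.
elim: n => // n IHn lt_n; rewrite mkseqS /=.
apply/allpairsPdep; exists (mkseq b n), (b n).
split=> //; first exact/IHn/ltnW.
rewrite mem_filter mem_iota /= ltnS ltn_ord andbT /fits size_mkseq.
apply/allP=> j; rewrite mem_iota /= => lt_jn; apply/implyP=> peer_nj.
have lt_j := ltn_trans lt_jn lt_n; rewrite nth_mkseq // eqSS.
by apply: properB; rewrite -?val_eqE /= !inordK // neq_ltn lt_jn orbT.
Qed.

Lemma boards_valid : all valid boards.
Proof. by vm_compute. Qed.

(** * Explicit elements of [H4] and the covering of all boards by six nests *)

Definition act (y s : seq nat) : seq nat := [seq nth 1 s i | i <- y].

Definition symmetry_table (y : seq nat) : bool :=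
  [&& size y == 16, all (fun i => i < 16) y, uniq y
    & all (fun i => all (fun j => peer i j ==> peer (nth 0 y i) (nth 0 y j))
                        (iota 0 16)) (iota 0 16)].

(** [act y] reads cell i from cell y_i, whereas [move] by x reads it from the preimage of i under x;
    hence the inverse of the tabulated permutation. Reading through an injective map that preserves
    peers keeps boards proper. *)
Lemma act_nest y s : symmetry_table y ->
  board_of (act y s) \in nest (board_of s).
Proof.
case/and4P=> /eqP size_y /(all_nthP 0) lt16 uniq_y /allP peer_y.
pose f (i : cell) : cell := inord (nth 0 y i).
have fE (i : cell) : f i = nth 0 y i :> nat by rewrite inordK // lt16 ?size_y.
have inj_f : injective f.
  move=> i j /(congr1 val); rewrite /= !fE => /eqP.
  by rewrite nth_uniq ?size_y // => /eqP/val_inj.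
have moveE B : move B (perm inj_f)^-1%g = [ffun j => B (f j)].
  by apply/ffunP=> j; rewrite !ffunE invgK permE.
apply/orbitP; exists (perm inj_f)^-1%g; last first.
  apply/ffunP=> j; rewrite /= moveE !ffunE /act fE (nth_map 0) ?size_y //.
rewrite !inE /=; apply/subsetP=> B /shidokuP properB.
rewrite inE /= moveE; apply/shidokuP=> i j neq_ij peer_ij; rewrite !ffunE.
apply: properB; first by rewrite (inj_eq inj_f).
have in_iota (k : cell) : val k \in iota 0 16 by rewrite mem_iota add0n ltn_ord.
have /peer_y/allP/(_ _ (in_iota j)) := in_iota i.
by rewrite !fE peer_ij.
Qed.

(* Every element of H4 is a product of some of these, in this order. *)
Definition tables : seq (seq nat) :=
  let rows rs := [seq 4 * i + j | i <- rs, j <- iota 0 4] in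
  let cols cs := [seq 4 * i + j | i <- iota 0 4, j <- cs] in
  [:: rows [:: 1; 0; 2; 3]; rows [:: 0; 1; 3; 2]; rows [:: 2; 3; 0; 1];
      cols [:: 1; 0; 2; 3]; cols [:: 0; 1; 3; 2]; cols [:: 2; 3; 0; 1];
      [seq 4 * j + i | i <- iota 0 4, j <- iota 0 4]].

(** Each of the seven tables doubles the list, which ends with 128 entries, counted with
    repetition. *)
Definition images (s : seq nat) : seq (seq nat) :=
  foldl (fun L y => L ++ map (act y) L) [:: s] tables.

Lemma images_nest s t : t \in images s -> board_of t \in nest (board_of s).
Proof.
have: all symmetry_table tables by vm_compute.
have: {in [:: s], forall t, board_of t \in nest (board_of s)}.
  by move=> _ /[!inE] /eqP ->; apply: orbit_refl.
(* The induction requires an arbitrary starting list contained in the nest. *)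
rewrite /images; elim: tables [:: s] => [|y ys IHys] L nestL /=; first by auto.
case/andP=> y_ok ys_ok; apply: IHys => // {}t; rewrite mem_cat => /orP[/nestL // |].
case/mapP=> t' /nestL Lt' ->; apply: orbit_trans Lt'; exact: act_nest.
Qed.

Definition rep_codes : seq (seq nat) :=
  [:: [:: 1; 2; 3; 4;  3; 4; 1; 2;  2; 1; 4; 3;  4; 3; 2; 1];
      [:: 1; 2; 3; 4;  4; 3; 1; 2;  2; 1; 4; 3;  3; 4; 2; 1];
      [:: 1; 2; 4; 3;  4; 3; 1; 2;  2; 1; 3; 4;  3; 4; 2; 1];
      [:: 1; 3; 2; 4;  4; 2; 1; 3;  3; 1; 4; 2;  2; 4; 3; 1];
      [:: 1; 3; 4; 2;  4; 2; 1; 3;  2; 1; 3; 4;  3; 4; 2; 1];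
      [:: 1; 3; 4; 2;  4; 2; 1; 3;  3; 1; 2; 4;  2; 4; 3; 1]].

Import GroupScope.

Lemma representativesP p :
  reflect (exists2 s, s \in rep_codes & p = board_of s) (p \in representatives).
Proof.
apply: (iffP idP) => [|[s s_rep ->]].
  rewrite !inE -!orbA.
  by do 5?[case/predU1P=> [->|]]; last move/eqP->; (eexists; last reflexivity).
have := map_f board_of s_rep; rewrite !inE -!orbA; exact: id.
Qed.

Lemma rep_codes_valid : all valid rep_codes.
Proof. by vm_compute. Qed.

Lemma representative_shidoku p : p \in representatives -> p \in shidoku.
Proof.
by case/representativesP=> s /(allP rep_codes_valid) s_ok ->; apply: valid_shidoku.
Qed.

Lemma nest_representative B : B \in shidoku ->
  exists2 p, p \in representatives & B \in nest p.
Proof.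
move/code_boards=> B_in.
have cover : all (fun s => has (fun t => s \in images t) rep_codes) boards.
  by vm_compute.
have /hasP[t t_rep B_t] := allP cover _ B_in.
exists (board_of t); first by apply/representativesP; exists t.
by rewrite -[B]codeK; apply: images_nest.
Qed.

(** * Computing the effect of a transposition on a representative *)

Definition swap_values (i j v : nat) : nat :=
  if v == i then j else if v == j then i else v.

Definition sends_code (i j : nat) (s t : seq nat) : bool :=
  [&& 0 < i <= 4, 0 < j <= 4, valid s & map (swap_values i j) s \in images t].

Lemma sends_of_code i j s t :
  sends_code i j s t -> sends (transp i j) (board_of s) (board_of t).
Proof.
case/and4P=> i4 j4 s_ok im_t; rewrite /sends.
suffices -> : relabel (board_of s) (transp i j) = board_of (map (swap_values i j) s).
  exact: images_nest.
apply/ffunP=> c; rewrite !ffunE /transp (nth_map 1%N); last first.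
  by case/and3P: s_ok => /eqP ->.
have v4 := valid_entry c s_ok; rewrite permE /= /swap_values.
by rewrite !(inj_in_eq entry_inj) //; do 2?case: eqP.
Qed.

(** * Invariants that separate orbits and nests *)

Definition agree (V : pred nat) (B C : board) : nat :=
  #|[set i | (B i == C i) && V (B i).+1]|.

Lemma agree_move V B C x : agree V (move B x) (move C x) = agree V B C.
Proof.
rewrite /agree -[RHS](card_imset _ (@perm_inj _ x)) -preim_permV.
by apply: eq_card => i; rewrite !inE !ffunE.
Qed.

Lemma agree_relabel B C u : agree predT (relabel B u) (relabel C u) = agree predT B C.
Proof. by apply: eq_card => i; rewrite !inE !ffunE (inj_eq perm_inj). Qed.

(** The total count ignores which values agree, so this is invariant under all of [G4]. *)
Definition lonely (B : board) : bool :=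
  [exists C in shidoku, agree predT B C == 1%N].

(** Counting value by value keeps track of the labels, so this can separate nests inside one orbit
    of [G4]. *)
Definition agrees_in (k : seq nat) (B : board) : bool :=
  [exists C in shidoku,
     all (fun v => agree (pred1 v) B C == nth 0%N k v.-1) (iota 1 4)].

(** A change of variable: an element stabilising [S] permutes it. *)
Lemma exists_act (aT : finGroupType) (T : finType) (to : {action aT &-> T})
    (S : {set T}) (P : pred T) (a : aT) : a \in 'N(S | to) ->
  [exists x in S, P (to x a)] = [exists x in S, P x].
Proof.
move=> nSa; apply/exists_inP/exists_inP=> [[x Sx Px] | [x Sx Px]].
  by exists (to x a); rewrite ?astabs_act.
by exists (to x a^-1); rewrite ?astabs_act ?groupV ?actKV.
Qed.

Lemma relabel_shidoku u : u \in 'N(shidoku | relabel_action).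
Proof.
rewrite !inE /=; apply/subsetP=> B /shidokuP properB; rewrite inE /=.
apply/shidokuP=> i j neq_ij peer_ij.
by rewrite !ffunE (inj_eq perm_inj) properB.
Qed.

Lemma lonely_symm B x u : x \in H4 -> lonely (symm B (x, u)) = lonely B.
Proof.
move=> H4x; rewrite /symm /lonely /= -(exists_act _ (relabel_shidoku u)) /=.
under eq_existsb => C do rewrite agree_relabel.
rewrite -(exists_act (to := move_action) _ H4x) /=.
by under eq_existsb => C do rewrite agree_move.
Qed.

Lemma agrees_in_nest k B C : C \in nest B -> agrees_in k C = agrees_in k B.
Proof.
case/orbitP=> x H4x <-; rewrite /agrees_in -(exists_act (to := move_action) _ H4x).
apply: eq_existsb => D; congr (_ && _).
by apply: eq_all => v; rewrite agree_move.
Qed.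

Definition agree_code (V : pred nat) (s t : seq nat) : nat :=
  count (fun i => (nth 1%N s i == nth 1%N t i) && V (nth 1%N s i)) (iota 0 16).

Lemma agree_board_of V s t : valid s -> valid t ->
  agree V (board_of s) (board_of t) = agree_code V s t.
Proof.
move=> s_ok t_ok; rewrite /agree_code -card_cell; apply: eq_card => i.
by rewrite !inE board_of_eq // board_ofE.
Qed.

(** Reduces a search over all boards to a scan of the enumeration, so that the invariants can be
    computed. *)
Lemma exists_boards (P : pred board) (Q : pred (seq nat)) :
    (forall t, valid t -> P (board_of t) = Q t) ->
  [exists C in shidoku, P C] = has Q boards.
Proof.
move=> PQ; apply/exists_inP/hasP=> [[C C_ok PC] | [t t_in Qt]].
  have C_in := code_boards C_ok; exists (code C) => //.
  by rewrite -PQ ?codeK // (allP boards_valid).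
have t_ok := allP boards_valid _ t_in.
by exists (board_of t); rewrite ?valid_shidoku ?PQ.
Qed.

Definition lonely_code (s : seq nat) : bool :=
  has (fun t => agree_code predT s t == 1%N) boards.

Lemma lonely_board_of s : valid s -> lonely (board_of s) = lonely_code s.
Proof. by move=> s_ok; apply: exists_boards => t t_ok; rewrite agree_board_of. Qed.

Lemma lonely_a : lonely board_a = false.
Proof. by rewrite lonely_board_of; vm_compute. Qed.

Lemma lonely_b : lonely board_b.
Proof. by rewrite lonely_board_of; vm_compute. Qed.

Definition agrees_in_code (k s : seq nat) : bool :=
  has (fun t => all (fun v => agree_code (pred1 v) s t == nth 0%N k v.-1) (iota 1 4))
      boards.

Lemma agrees_in_board_of k s : valid s -> agrees_in k (board_of s) = agrees_in_code k s.
Proof.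
move=> s_ok; apply: exists_boards => t t_ok.
by apply: eq_all => v; rewrite agree_board_of.
Qed.

(* Each vector singles out one of the pairings 12|34, 13|24, 14|23; two of them
   occur for a, c, f and one for b, d, e, a different set for each board. *)
Definition signature (s : seq nat) : seq bool :=
  [seq agrees_in_code k s
  | k <- [:: [:: 2; 2; 4; 4]; [:: 2; 4; 2; 4]; [:: 2; 4; 4; 2]]%N].

Lemma uniq_map_inj (T1 T2 : eqType) (f : T1 -> T2) (s : seq T1) :
  uniq (map f s) -> {in s &, injective f}.
Proof.
elim: s => //= x s IHs /andP[fx_notin /IHs inj_f] y z.
rewrite !inE => /predU1P[-> | s_y] /predU1P[-> | s_z] // eq_f; last exact: inj_f.
- by case/mapP: fx_notin; exists z.
- by case/mapP: fx_notin; exists y.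
Qed.

Lemma nest_inj p q : p \in representatives -> q \in representatives ->
  q \in nest p -> q = p.
Proof.
have sep : uniq (map signature rep_codes) by vm_compute.
case/representativesP=> s s_rep -> /representativesP[t t_rep ->] nest_st.
have eq_sig : signature t = signature s.
  rewrite /signature; apply: eq_map => k.
  rewrite -(agrees_in_board_of k (allP rep_codes_valid _ t_rep)).
  rewrite -(agrees_in_board_of k (allP rep_codes_valid _ s_rep)).
  exact: agrees_in_nest.
by rewrite (uniq_map_inj sep t_rep s_rep eq_sig).
Qed.

(** * Orbits under [H4] and a relabeling group, and components of the graph *)

Section Orbits.

Variable S : {group 'S_4}.

Definition sym_orbit (B : board) : {set board} :=
  orbit symm_action (setX_group H4 S) B.

Lemma mem_sym_orbit B C :
  reflect (exists x u, [/\ x \in H4, u \in S & C = relabel (move B x) u])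
          (C \in sym_orbit B).
Proof.
apply: (iffP orbitP) => [[[x u]] | [x [u [H4x Su ->]]]].
  by rewrite inE => /andP[H4x Su] <-; exists x, u.
by exists (x, u) => //; rewrite inE; apply/andP.
Qed.

Lemma sym_orbit_eqP B C : reflect (sym_orbit C = sym_orbit B) (C \in sym_orbit B).
Proof. exact: orbit_eqP. Qed.

Lemma nest_sym_orbit B C : C \in nest B -> sym_orbit C = sym_orbit B.
Proof.
case/orbitP=> x H4x <-; apply/sym_orbit_eqP/mem_sym_orbit.
by exists x, 1; rewrite relabel1.
Qed.

Lemma sends_sym_orbit u p q : u \in S -> sends u p q -> sym_orbit p = sym_orbit q.
Proof.
move=> Su /nest_sym_orbit <-; apply/esym/sym_orbit_eqP/mem_sym_orbit.
by exists 1, u; rewrite move1.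
Qed.

Lemma orbits_on_representatives :
  orbits_on_shidoku (setX_group H4 S) = sym_orbit @: representatives.
Proof.
apply/setP=> A; apply/imsetP/imsetP=> [[B B_ok ->] | [p p_rep ->]].
  have [p p_rep /nest_sym_orbit eq_orb] := nest_representative B_ok.
  by exists p.
by exists p => //; apply: representative_shidoku.
Qed.

Variable X : {set 'S_4}.
Hypothesis genX : <<X>> = S.

Lemma rep_graph_sym : symmetric (rep_graph X).
Proof.
move=> p q; rewrite /rep_graph andbCA; congr [&& _, _ & _].
by apply: eq_existsb => u; rewrite orbC.
Qed.

(** Edges stay inside an orbit because [X] lies in [S]. Conversely, the boards in nests reachable
    from [p] form a set stable under [S], so it contains [q]. *)
Lemma connect_sym_orbit p q : p \in representatives -> q \in representatives ->
  connect (rep_graph X) p q = (sym_orbit p == sym_orbit q).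
Proof.
move=> p_rep q_rep; apply/idP/eqP=> [| /eqP].
  case/connectP=> r + ->; elim: r p {p_rep q_rep} => //= p' r IHr p /andP[edge /IHr <-].
  case/and3P: edge => _ _ /exists_inP[u Xu].
  have Su : u \in S by rewrite -genX mem_gen.
  by case/orP=> /(sends_sym_orbit Su).
rewrite eq_sym => /eqP/sym_orbit_eqP/mem_sym_orbit[x [u [H4x Su q_eq]]].
pose U := [set B | [exists r in representatives,
                      connect (rep_graph X) p r && (B \in nest r)]].
have nUX : X \subset 'N(U | relabel_action).
  apply/subsetP=> v Xv; rewrite !inE /=; apply/subsetP=> B.
  rewrite !inE => /exists_inP[r r_rep /andP[pr r_B]].
  have B_ok : relabel r v \in shidoku.
    by rewrite (astabs_act _ (relabel_shidoku v)) representative_shidoku.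
  have [r' r'_rep r'_B] := nest_representative B_ok.
  apply/exists_inP; exists r' => //; apply/andP; split.
    apply: connect_trans pr _; apply: connect1; apply/and3P; split=> //.
    by apply/exists_inP; exists v => //; apply/orP; left.
  (* Relabelings commute with cell moves, so they carry nests to nests. *)
  apply: orbit_trans r'_B; case/orbitP: r_B => y H4y <-.
  apply/orbitP; exists y => //=.
  by apply/ffunP=> i; rewrite !ffunE.
have Uq : q \in U.
  (* The stabiliser of [U] is a group containing [X], hence it contains [u]. *)
  rewrite q_eq (astabs_act (to := relabel_action)); last first.
    by apply: (subsetP (_ : S \subset _)) Su; rewrite -genX gen_subG.
  rewrite inE; apply/exists_inP; exists p => //; rewrite connect0 /=.
  exact: mem_orbit.
move: Uq; rewrite inE => /exists_inP[r r_rep /andP[pr r_q]].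
by rewrite (nest_inj r_rep q_rep r_q).
Qed.

End Orbits.

(** The roots of the components in [A] form a transversal on which [f] is injective, with the same
    image as [A]. *)
Lemma n_comp_imset (T rT : finType) (e : rel T) (A : {set T}) (f : T -> rT) :
    connect_sym e -> closed e A ->
    {in A &, forall x y, connect e x y = (f x == f y)} ->
  n_comp e A = #|f @: A|.
Proof.
move=> e_sym clA conn_f; have rootA x : (root e x \in A) = (x \in A).
  by rewrite (closed_connect clA (connect_root e x)).
rewrite /n_comp_mem -(card_in_imset (f := f)) => [|x y].
  congr #|pred_of_set _|; apply/setP=> z; apply/imsetP/imsetP=> [[x] | [x Ax ->]].
    by rewrite !inE => /andP[_ Ax] ->; exists x.
  exists (root e x); first by rewrite !inE (roots_root e_sym) rootA.
  by apply/eqP; rewrite -conn_f ?rootA ?connect_root.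
rewrite !inE => /andP[/eqP root_x Ax] /andP[/eqP root_y Ay] /eqP.
by rewrite -conn_f // -(root_connect e_sym) root_x root_y => /eqP.
Qed.

Lemma components_orbits (S : {group 'S_4}) (X : {set 'S_4}) : <<X>> = S ->
  components X = #|orbits_on_shidoku (setX_group H4 S)|.
Proof.
move=> genX; rewrite orbits_on_representatives; apply: n_comp_imset.
- exact/sym_connect_sym/rep_graph_sym.
- by move=> p q /and3P[p_rep q_rep _]; rewrite p_rep q_rep.
- exact: connect_sym_orbit.
Qed.

(** * The table of the action and the two orbits of [G4] *)

Lemma swaps_12_34 u : u \in [set transp 1 2; transp 3 4] ->
  [/\ swaps u board_a board_c, sends u board_f board_f,
      swaps u board_d board_e & sends u board_b board_b].
Proof.
by case/set2P=> ->; split; try split; apply: sends_of_code; vm_compute.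
Qed.

Lemma swaps_23_14 u : u \in [set transp 2 3; transp 1 4] ->
  [/\ swaps u board_c board_f, sends u board_a board_a,
      swaps u board_b board_d & sends u board_e board_e].
Proof.
by case/set2P=> ->; split; try split; apply: sends_of_code; vm_compute.
Qed.

(** The transpositions moving 1 generate the whole group, and the only one not listed, (1 3), is a
    conjugate of (1 2) by (2 3). *)
Lemma transpositions_generate :
  <<[set transp 1 2; transp 2 3; transp 3 4; transp 1 4]>> = [set: 'S_4].
Proof.
set X := [set _; _; _; _]; apply/eqP; rewrite eqEsubset subsetT -(gen_tperm (entry 1)).
have X12 : transp 1 2 \in <<X>> by rewrite mem_gen // !inE eqxx.
have X23 : transp 2 3 \in <<X>> by rewrite mem_gen // !inE eqxx !orbT.
have X14 : transp 1 4 \in <<X>> by rewrite mem_gen // !inE eqxx !orbT.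
rewrite gen_subG; apply/subsetP=> _ /imsetP[v _ ->].
have -> : v = entry v.+1 by rewrite /entry inord_val.
case: v => [[|[|[|[|]]]] //= _] //.
  by rewrite tperm1 group1.
suffices -> : tperm (entry 1) (entry 3) = transp 1 2 ^ transp 2 3 by rewrite groupJ.
by rewrite /transp tpermJ tpermL tpermD // (inj_in_eq entry_inj).
Qed.

(** The relabelings (1 2) and (2 3) join a, c, f and likewise b, d, e; [lonely] keeps the two
    classes apart. *)
Lemma card_orbits_G4 : #|orbits_on_shidoku G4| = 2.
Proof.
pose O := sym_orbit [group of [set: 'S_4]].
have sends_O u p q : sends u p q -> O p = O q by apply: sends_sym_orbit; rewrite inE.
have u12 : transp 1 2 \in [set transp 1 2; transp 3 4] by rewrite !inE eqxx.
have u23 : transp 2 3 \in [set transp 2 3; transp 1 4] by rewrite !inE eqxx.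
have [[/sends_O ac _] _ [/sends_O de _] _] := swaps_12_34 u12.
have [[/sends_O cf _] _ [/sends_O bd _] _] := swaps_23_14 u23.
have neq_ab : O board_a != O board_b.
  apply/eqP=> /esym/sym_orbit_eqP/mem_sym_orbit[x [u [H4x _ b_eq]]].
  by have := lonely_b; rewrite b_eq (lonely_symm board_a u H4x) lonely_a.
suffices -> : orbits_on_shidoku G4 = [set O board_a; O board_b].
  by rewrite cards2 neq_ab.
rewrite (orbits_on_representatives [group of [set: 'S_4]]) -/O.
rewrite /representatives !imsetU !imset_set1 -cf -ac -de -bd.
by apply/setP=> A; rewrite !inE; do 2?case: (A == _).
Qed.

(** Sending each [G]-orbit to the [K]-orbit around it is onto; equal finite cardinals make it
    injective, so no [K]-orbit splits. *)
Lemma eq_orbits_card (aT : finGroupType) (T : finType) (to : {action aT &-> T})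
    (G K : {group aT}) (S : {set T}) :
    G \subset K -> [acts K, on S | to] ->
    #|[set orbit to G x | x in S]| = #|[set orbit to K x | x in S]| ->
  [set orbit to G x | x in S] = [set orbit to K x | x in S].
Proof.
move=> sGK nSK eq_card.
(* The union makes [f] a function of the orbit alone, with no choice of a point. *)
pose f (A : {set T}) := \bigcup_(x in A) orbit to K x.
have f_orbit x : f (orbit to G x) = orbit to K x.
  apply/setP=> y; apply/bigcupP/idP=> [[z Gxz] | Kxy]; last first.
    by exists x; rewrite ?orbit_refl.
  by move/orbit_trans; apply; apply: (subsetP (imsetS _ sGK)).
have orbK : [set orbit to K x | x in S] = f @: [set orbit to G x | x in S].
  by rewrite -imset_comp; apply: eq_imset => x; rewrite /= f_orbit.
have /imset_injP inj_f :
    #|f @: [set orbit to G x | x in S]| == #|[set orbit to G x | x in S]|.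
  by rewrite -orbK eq_card.
apply: eq_in_imset => x Sx; apply/eqP; rewrite eqEsubset imsetS //=.
apply/subsetP=> y Kxy; apply/orbit_eqP/inj_f.
- by apply: imset_f; rewrite (subsetP _ _ Kxy) // acts_sub_orbit.
- exact: imset_f.
- by rewrite !f_orbit; apply/orbit_eqP.
Qed.

Lemma G4_acts : [acts G4, on shidoku | symm_action].
Proof.
apply/subsetP=> [[x u]] /setXP[H4x _]; rewrite !inE /=; apply/subsetP=> B B_ok.
rewrite inE /= /symm /= (astabs_act (to := relabel_action) _ (relabel_shidoku u)).
by rewrite (astabs_act (to := move_action) _ H4x).
Qed.

Theorem theorem4 :
  [/\ (forall B : board, B \in shidoku ->
         exists2 p : board, p \in representatives & B \in nest p),
      <<[set transp 1 2; transp 2 3; transp 3 4; transp 1 4]>> = [set: 'S_4],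
      (forall u : 'S_4, u \in [set transp 1 2; transp 3 4] ->
         [/\ swaps u board_a board_c, sends u board_f board_f,
             swaps u board_d board_e & sends u board_b board_b]),
      (forall u : 'S_4, u \in [set transp 2 3; transp 1 4] ->
         [/\ swaps u board_c board_f, sends u board_a board_a,
             swaps u board_b board_d & sends u board_e board_e])
    & (forall (S' : {group 'S_4}) (X : {set 'S_4}), <<X>> = S' ->
         complete_symmetry_group (setX_group H4 S') <-> components X = 2)].
Proof.
split.
- exact: nest_representative.
- exact: transpositions_generate.
- exact: swaps_12_34.
- exact: swaps_23_14.
- move=> S' X genX; rewrite (components_orbits genX).
  have sGG4 : setX_group H4 S' \subset G4 by apply: setXS; rewrite ?subsetT.
  split=> [[_ ->] | card2]; [exact: card_orbits_G4 | split=> //].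
  exact: eq_orbits_card sGG4 G4_acts (etrans card2 (esym card_orbits_G4)).
Qed.
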